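(* Let $\Theta$ be a parameter set and $L:\Theta\to[0,\infty)$ the likelihood function based on the observed data. Let ''there is evidence supporting $H_1$ over $H_2$'' be a binary relation between hypotheses $H_1:\theta\in\Theta_1$ and $H_2:\theta\in\Theta_2$ (with $\Theta_1,\Theta_2\subset\Theta$) that satisfies the following two axioms. Axiom 1. If $\inf L(\Theta_1)>\sup L(\Theta_2)$, then there is evidence supporting $H_1$ over $H_2$. Axiom 2. If there is evidence supporting $H_1^*$ over $H_2$ and $H_1^*$ implies $H_1$, then there is evidence supporting $H_1$ over $H_2$. Then for all hypotheses $H_1:\theta\in\Theta_1$ and $H_2:\theta\in\Theta_2$ with $\Theta_1,\Theta_2\subset\Theta$: if $\sup L(\Theta_1)>\sup L(\Theta_2)$, then there is evidence supporting $H_1$ over $H_2$.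
   Context: The data $X$ follow a distribution with density $f(\cdot;\theta)$, known up to a parameter $\theta\in\Theta$; having observed $X=x$, the likelihood is $L(\theta)=f(x;\theta)$. For $A\subset\Theta$, $L(A)=\{L(\theta):\theta\in A\}$. A hypothesis is identified with a subset of $\Theta$ (the hypothesis $\theta\in A$ with the set $A$); a hypothesis $H_1^*:\theta\in\Theta_1^*$ implies $H_1:\theta\in\Theta_1$ when $\Theta_1^*\subset\Theta_1$. Suprema are taken in $[0,\infty]$, with $\sup\emptyset=0$. ''There is evidence supporting $H_1$ over $H_2$'' is a primitive (undefined) binary relation on hypotheses, for fixed $L$, about which only Axioms 1 and 2 are assumed. Axiom 1 is required to hold for all $\Theta_1,\Theta_2\subset\Theta$ with $\Theta_1$ nonempty; Axiom 2 for all hypotheses. *)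

(* Defs.v *)
From mathcomp Require Import all_boot all_order all_algebra.
From mathcomp Require Import boolp classical_sets reals ereal.

Set Implicit Arguments.
Unset Strict Implicit.
Unset Printing Implicit Defensive.

Local Open Scope classical_set_scope.
Local Open Scope ereal_scope.

(* A hypothesis "theta \in A" is the subset A of the parameter set Theta, and
   "H1* implies H1" is inclusion of subsets. "There is evidence supporting H1
   over H2" is a relation ev : set Theta -> set Theta -> Prop (ev H1 H2), for a
   fixed likelihood L. *)

Section Likelihood.
Context {R : realType} {Theta : Type}.
Implicit Types (L : Theta -> R) (A : set Theta).

Definition lik_image L A : set (\bar R) := [set (L t)%:E | t in A].

(* The library's ereal_sup gives -oo on the empty set; a supremum taken in
   [0, +oo] gives 0 instead. For nonempty A the two agree (lik_supE). *)
Definition lik_sup L A : \bar R := supremum 0 (lik_image L A).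

Definition lik_inf L A : \bar R := ereal_inf (lik_image L A).

Lemma lik_sup0 L : lik_sup L set0 = 0.
Proof. by rewrite /lik_sup /lik_image image_set0 supremum0. Qed.

Lemma lik_supE L A : A !=set0 -> lik_sup L A = ereal_sup (lik_image L A).
Proof.
move=> [t At]; rewrite /lik_sup /ereal_sup /supremum.
have /set0P/negPf -> : lik_image L A !=set0 by exists (L t)%:E, t.
have [s Hs] := ereal_supremums_neq0 (lik_image L A).
case: xgetP => [x _ [ux lx]|/(_ s)/(_ Hs)//].
case: xgetP => [y _ [uy ly]|/(_ s)/(_ Hs)//].
by apply/Order.le_anti; rewrite lx// ly.
Qed.

Definition evidence_axiom1 L (ev : set Theta -> set Theta -> Prop) : Prop :=
  forall A1 A2, A1 !=set0 -> lik_inf L A1 > lik_sup L A2 -> ev A1 A2.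

Definition evidence_axiom2 (ev : set Theta -> set Theta -> Prop) : Prop :=
  forall A1s A1 A2, ev A1s A2 -> A1s `<=` A1 -> ev A1 A2.

End Likelihood.

(* Main.v *)
Require Import Defs.
From mathcomp Require Import all_boot all_order all_algebra.
From mathcomp Require Import boolp classical_sets reals ereal.

(** If [sup L(Theta1) > sup L(Theta2)], the number [sup L(Theta2)] is not an
    upper bound of [L] on [Theta1], so a single point [t] of [Theta1] already
    satisfies [L t > sup L(Theta2)]. For the simple hypothesis [[set t]] the
    infimum of the likelihood is [L t], so the first axiom supports [[set t]]
    over [Theta2]; since [[set t]] implies [Theta1], the second axiom carries
    the support over to [Theta1]. Choosing [t] needs [Theta1] nonempty, which
    follows from [sup L(Theta1) > sup L(Theta2) >= 0]: this is where the
    nonnegativity of [L] and the convention that the supremum of the empty set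
    is [0] enter. *)

Import Order.TTheory.
Local Open Scope classical_set_scope.

Lemma lik_sup_ge0 (R : realType) (Theta : Type) (L : Theta -> R)
    (A : set Theta) :
  (forall t, (0 <= L t)%R) -> (0 <= lik_sup L A)%E.
Proof.
move=> L_ge0; have [->|A0] := eqVneq A set0; first by rewrite lik_sup0.
have /set0P[t At] := A0.
rewrite lik_supE; last by exists t.
apply: (@le_trans _ _ (L t)%:E); first by rewrite lee_fin.
by apply: ereal_sup_ubound; exists t.
Qed.

Lemma lik_inf1 (R : realType) (Theta : Type) (L : Theta -> R) (t : Theta) :
  lik_inf L [set t] = (L t)%:E.
Proof. by rewrite /lik_inf /lik_image image_set1 ereal_inf1. Qed.

Theorem theorem1 (R : realType) (Theta : Type) (L : Theta -> R)
    (ev : set Theta -> set Theta -> Prop)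
    (L_ge0 : forall t : Theta, (0 <= L t)%R)
    (ax1 : evidence_axiom1 L ev)
    (ax2 : evidence_axiom2 ev)
    (Theta1 Theta2 : set Theta)
    (sup_gt : (lik_sup L Theta1 > lik_sup L Theta2)%E) :
  ev Theta1 Theta2.
Proof.
have Theta1_neq0 : Theta1 !=set0.
  apply/set0P/eqP => Theta1_eq0; move: sup_gt.
  by rewrite Theta1_eq0 lik_sup0 ltNge lik_sup_ge0.
move: sup_gt; rewrite (lik_supE _ Theta1_neq0).
move=> /ereal_sup_gt[_ [t Theta1t <-] Lt].
apply: (ax2 [set t]); last by move=> _ ->.
by apply: ax1; [exists t | rewrite lik_inf1].
Qed.
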